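(* Let $A,P\in\mathbb{R}^{n\times n}$ be invertible, $b\in\mathbb{R}^n$, and consider AAr($m$) used to accelerate the preconditioned Richardson iteration $q(x)=x+P(b-Ax)$ for solving $Ax=b$. Let $B=I-PA$ and $r_k=P(Ax_k-b)$. Then for every $k\ge0$ the least-squares problem defining $\boldsymbol{\alpha}^{(k)}$ can be rewritten as $$\min_{\boldsymbol{\alpha}^{(k)}}\|r_{k+1}\|^2=\min_{\boldsymbol{\alpha}^{(k)}}\|B(r_k-R_k\boldsymbol{\alpha}^{(k)})\|^2,$$ i.e. for every coefficient vector $\boldsymbol{\alpha}^{(k)}$ its objective equals $\|r_{k+1}\|^2$ (with $x_{k+1}$, hence $r_{k+1}$, regarded as a function of $\boldsymbol{\alpha}^{(k)}$) and equals $\|B(r_k-R_k\boldsymbol{\alpha}^{(k)})\|^2$, where $$R_k=[\,r_{k-1}-r_k,\ r_{k-2}-r_k,\ \dots,\ r_{k-m_k}-r_k\,].$$ Moreover, for the iterates generated by AAr($m$) and all $i,j=0,1,\dots,m_k$, $$r_{k+1}^TB(r_{k-j}-r_{k-i})=0,\qquad \|r_{k+1}\|\le\|Br_k\|.$$ If $\|B\|<1$, then $\|r_{k+1}\|<\|r_k\|$ for every $k$ with $r_k\neq0$, and AAr($m$) converges, i.e. $x_k\to A^{-1}b$.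
   Context: $\|\cdot\|$ is the 2-norm for vectors and matrices, and $r(x)=x-q(x)=P(Ax-b)$ is the preconditioned residual. AAr($m$), $m\ge0$ an integer: given $x_0\in\mathbb{R}^n$, for $k=0,1,2,\dots$ let $m_k=\min\{k,m\}$ and set $$x_{k+1}=q(x_k)+\sum_{i=1}^{m_k}\alpha_i^{(k)}\big(q(x_k)-q(x_{k-i})\big),$$ where $\boldsymbol{\alpha}^{(k)}=(\alpha_1^{(k)},\dots,\alpha_{m_k}^{(k)})\in\mathbb{R}^{m_k}$ is obtained by solving the least-squares problem $$\min_{\boldsymbol{\alpha}^{(k)}}\Big\|r(q(x_k))+\sum_{i=1}^{m_k}\alpha_i^{(k)}\big(r(q(x_k))-r(q(x_{k-i}))\big)\Big\|^2 .$$ When $m_k=0$ the sums are empty. *)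

(* Defs.v *)
From HB Require Import structures.
From mathcomp Require Import all_boot all_order all_algebra.
From mathcomp Require Import all_classical all_reals all_analysis.
Set Implicit Arguments.
Unset Strict Implicit.
Unset Printing Implicit Defensive.
Import Order.TTheory GRing.Theory Num.Theory.
Import numFieldNormedType.Exports.
Local Open Scope classical_set_scope.
Local Open Scope ring_scope.

(* The library norm `|v| on matrices is the max norm, so the Euclidean norm
   and the spectral norm are defined here. *)
Definition norm2 (R : realType) (n : nat) (v : 'cV[R]_n) : R :=
  Num.sqrt (\sum_(i < n) v i 0 ^+ 2).

Definition mxnorm2 (R : realType) (p n : nat) (M : 'M[R]_(p, n)) : R :=
  sup [set norm2 (M *m v) | v in [set v : 'cV[R]_n | norm2 v <= 1]].

Definition richardson (R : realType) (n : nat) (A P : 'M[R]_n) (b : 'cV[R]_n)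
  (x : 'cV[R]_n) : 'cV[R]_n := x + P *m (b - A *m x).

Definition presidual (R : realType) (n : nat) (A P : 'M[R]_n) (b : 'cV[R]_n)
  (x : 'cV[R]_n) : 'cV[R]_n := P *m (A *m x - b).

(* The mathematical indices i = 1, ..., m_k, with m_k = minn k m, are encoded
   by i : 'I_(minn k m) standing for i.+1. *)
Definition AAr_step (R : realType) (n : nat) (q : 'cV[R]_n -> 'cV[R]_n)
    (m : nat) (x : nat -> 'cV[R]_n) (k : nat) (a : 'cV[R]_(minn k m)) :
    'cV[R]_n :=
  q (x k) + \sum_(i < minn k m) a i 0 *: (q (x k) - q (x (k - i.+1)%N)).

Definition AAr_objective (R : realType) (n : nat) (q : 'cV[R]_n -> 'cV[R]_n)
    (m : nat) (x : nat -> 'cV[R]_n) (k : nat) (a : 'cV[R]_(minn k m)) : R :=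
  let r y := y - q y in
  norm2 (r (q (x k)) +
    \sum_(i < minn k m) a i 0 *: (r (q (x k)) - r (q (x (k - i.+1)%N)))) ^+ 2.

(* The least-squares minimizer need not be unique: any choice is allowed. *)
Definition is_AAr (R : realType) (n : nat) (q : 'cV[R]_n -> 'cV[R]_n)
    (m : nat) (x : nat -> 'cV[R]_n) (alpha : forall k, 'cV[R]_(minn k m)) :
    Prop :=
  forall k : nat,
    (forall a : 'cV[R]_(minn k m),
       AAr_objective q x (alpha k) <= AAr_objective q x a) /\
    x k.+1 = AAr_step q x (alpha k).

Definition residual_diff_mx (R : realType) (n m : nat) (r : nat -> 'cV[R]_n)
    (k : nat) : 'M[R]_(n, minn k m) :=
  \matrix_(l < n, i < minn k m) (r (k - i.+1)%N - r k) l 0.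

(* Main.v *)
Require Import Defs.
From HB Require Import structures.
From mathcomp Require Import all_boot all_order all_algebra.
From mathcomp Require Import all_classical all_reals all_analysis.
From mathcomp Require Import ring.
Set Implicit Arguments.
Unset Strict Implicit.
Unset Printing Implicit Defensive.
Import Order.TTheory GRing.Theory Num.Theory.
Import numFieldNormedType.Exports.
Local Open Scope classical_set_scope.
Local Open Scope ring_scope.

(** The preconditioned residual of the Richardson map is affine, and applying
    the map once multiplies it by [B = I - PA]; affinity lets the residual pass
    through the affine combination defining an AAr step.  So a step with
    coefficients [a] has residual [B (r_k - R_k a)], and this very vector is
    what the least-squares objective measures ([presidual_AAr_step],
    [AAr_objectiveE]).

    Minimality of [alpha k] then gives the normal equations: the optimal
    residual is orthogonal to the range of [B R_k] ([least_squares_orthogonal]),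
    and every [r_(k-j) - r_(k-i)] lies in the range of [R_k].  Comparing the
    minimizer with the competitor [a = 0] gives [|r_(k+1)| <= |B r_k|], hence
    [|r_k| <= |B|^k |r_0|].  If [|B| < 1] the residuals tend to zero
    geometrically, and so do the errors
    [x_k - A^-1 b = (PA)^-1 r_k] ([geometric_residual_cvg]). *)

(** * Euclidean and spectral norms *)

Lemma norm2_sqr (R : realType) (n : nat) (v : 'cV[R]_n) :
  norm2 v ^+ 2 = (v^T *m v) 0 0.
Proof.
rewrite /norm2 sqr_sqrtr; last by apply: sumr_ge0 => i _; exact: sqr_ge0.
by rewrite mxE; apply: eq_bigr => i _; rewrite mxE expr2.
Qed.

Lemma norm2_ge0 (R : realType) (n : nat) (v : 'cV[R]_n) : 0 <= norm2 v.
Proof. exact: sqrtr_ge0. Qed.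

Lemma norm2Z (R : realType) (n : nat) (t : R) (v : 'cV[R]_n) :
  norm2 (t *: v) = `|t| * norm2 v.
Proof.
rewrite /norm2 -sqrtr_sqr -sqrtrM ?sqr_ge0 // mulr_sumr; congr Num.sqrt.
by apply: eq_bigr => i _; rewrite mxE exprMn.
Qed.

Lemma norm2_0 (R : realType) (n : nat) : norm2 (0 : 'cV[R]_n) = 0.
Proof. by rewrite -(scale0r (0 : 'cV[R]_n)) norm2Z normr0 mul0r. Qed.

Lemma coord_le_norm2 (R : realType) (n : nat) (v : 'cV[R]_n) (i : 'I_n) :
  `|v i 0| <= norm2 v.
Proof.
rewrite /norm2 -sqrtr_sqr ler_sqrt; last first.
  by apply: sumr_ge0 => j _; exact: sqr_ge0.
by rewrite (bigD1 i) //= lerDl; apply: sumr_ge0 => j _; exact: sqr_ge0.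
Qed.

Lemma norm2_gt0 (R : realType) (n : nat) (v : 'cV[R]_n) :
  v != 0 -> 0 < norm2 v.
Proof.
move=> v0; rewrite lt_neqAle norm2_ge0 andbT eq_sym; apply: contra v0 => /eqP v0.
apply/eqP/matrixP => i j; rewrite ord1 mxE; apply/eqP; rewrite -normr_le0 -v0.
exact: coord_le_norm2.
Qed.

(** Without this bound the supremum defining [mxnorm2] would be a junk value.
    Coordinates of a vector in the unit ball are at most 1, so each entry of
    [M *m v] is at most the absolute row sum of [M]. *)
Lemma norm2_mulmx_unit_ball_bounded (R : realType) (p n : nat)
    (M : 'M[R]_(p, n)) :
  has_ubound [set norm2 (M *m v) | v in [set v : 'cV[R]_n | norm2 v <= 1]].
Proof.
exists (Num.sqrt (\sum_i (\sum_j `|M i j|) ^+ 2)) => _ [v /= v1 <-].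
rewrite ler_sqrt; last by apply: sumr_ge0 => i _; exact: sqr_ge0.
apply: ler_sum => i _; rewrite -real_normK ?num_real // lerXn2r ?nnegrE //.
  exact: sumr_ge0.
rewrite mxE; apply: le_trans (ler_norm_sum _ _ _) _; apply: ler_sum => j _.
by rewrite normrM ler_piMr // (le_trans (coord_le_norm2 v j)).
Qed.

Lemma mxnorm2_ge0 (R : realType) (p n : nat) (M : 'M[R]_(p, n)) :
  0 <= mxnorm2 M.
Proof.
apply: (ub_le_sup (norm2_mulmx_unit_ball_bounded M)).
by exists 0; rewrite /= ?mulmx0 norm2_0.
Qed.

Lemma norm2_mulmx_le (R : realType) (p n : nat) (M : 'M[R]_(p, n))
    (v : 'cV[R]_n) : norm2 (M *m v) <= mxnorm2 M * norm2 v.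
Proof.
have [->|v0] := eqVneq v 0; first by rewrite mulmx0 !norm2_0 mulr0.
have nv := norm2_gt0 v0.
rewrite -ler_pdivrMr // mulrC.
have -> : (norm2 v)^-1 * norm2 (M *m v) = norm2 (M *m ((norm2 v)^-1 *: v)).
  by rewrite -scalemxAr norm2Z ger0_norm // invr_ge0 ltW.
apply: (ub_le_sup (norm2_mulmx_unit_ball_bounded M)).
exists ((norm2 v)^-1 *: v) => //=.
by rewrite norm2Z ger0_norm ?invr_ge0 ?(ltW nv) // mulVf ?gt_eqF.
Qed.

(** * Normal equations *)

Lemma norm2_sqrD (R : realType) (n : nat) (w d : 'cV[R]_n) (t : R) :
  norm2 (w + t *: d) ^+ 2 =
  norm2 w ^+ 2 + t * ((w^T *m d) 0 0 *+ 2) + t ^+ 2 * norm2 d ^+ 2.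
Proof.
have dwC : d^T *m w = w^T *m d.
  by rewrite -[LHS]trmxK trmx_mul trmxK; apply/matrixP => i j; rewrite !ord1 mxE.
have -> : norm2 (w + t *: d) ^+ 2 = ((w^T + t *: d^T) *m (w + t *: d)) 0 0.
  by rewrite norm2_sqr; congr ((_ *m _) _ _); apply/matrixP => i j; rewrite !mxE.
rewrite !norm2_sqr mulmxDl !mulmxDr -!scalemxAl -!scalemxAr dwC scalerA.
set ww := w^T *m w; set wd := w^T *m d; set dd := d^T *m d.
by rewrite !mxE; ring.
Qed.

(** If [w] is the shortest vector on the line [w + t d], the derivative
    [2 <w, d>] of the squared length at [t = 0] must vanish. *)
Lemma orthogonal_of_line_minimal (R : realType) (n : nat) (w d : 'cV[R]_n) :
  (forall t, norm2 w ^+ 2 <= norm2 (w + t *: d) ^+ 2) -> w^T *m d = 0.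
Proof.
move=> min_w; apply/matrixP => i j; rewrite !ord1 [RHS]mxE.
set p := (w^T *m d) 0 0; set N := norm2 d ^+ 2.
have N0 : 0 <= N by exact: sqr_ge0.
have N1 : 0 < N + 1 by rewrite ltr_wpDl.
(* The exact minimizer is -p / N; the shift by 1 also covers d = 0. *)
have := min_w (- (p / (N + 1))).
rewrite norm2_sqrD -/p -/N -addrA lerDl.
have -> : - (p / (N + 1)) * (p *+ 2) + (- (p / (N + 1))) ^+ 2 * N =
  - ((p / (N + 1)) ^+ 2 * (N + 2)) by field; rewrite gt_eqF.
rewrite oppr_ge0 pmulr_lle0; last by rewrite ltr_wpDl.
rewrite le_eqVlt ltNge sqr_ge0 orbF sqrf_eq0 mulf_eq0 invr_eq0 (gt_eqF N1) orbF.
by move/eqP.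
Qed.

Lemma least_squares_orthogonal (R : realType) (n p : nat) (D : 'M[R]_(n, p))
    (c : 'cV[R]_n) (a0 : 'cV[R]_p) :
  (forall a, norm2 (c - D *m a0) ^+ 2 <= norm2 (c - D *m a) ^+ 2) ->
  forall s : 'cV[R]_p, (c - D *m a0)^T *m (D *m s) = 0.
Proof.
move=> min_a0 s; apply: orthogonal_of_line_minimal => t.
have := min_a0 (a0 - t *: s).
by rewrite mulmxBr -scalemxAr opprB addrA addrAC.
Qed.

(** * Residuals of the Richardson map *)

Lemma subr_richardson (R : realType) (n : nat) (A P : 'M[R]_n)
    (b y : 'cV[R]_n) : y - richardson A P b y = presidual A P b y.
Proof. by rewrite /richardson /presidual opprD addNKr -mulmxN opprB. Qed.

Lemma presidual_richardson (R : realType) (n : nat) (A P : 'M[R]_n)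
    (b y : 'cV[R]_n) :
  presidual A P b (richardson A P b y) = (1%:M - P *m A) *m presidual A P b y.
Proof.
have -> : richardson A P b y = y - presidual A P b y.
  by rewrite -subr_richardson subKr.
rewrite {1}/presidual [A *m _]mulmxBr addrAC mulmxBr -/(presidual A P b y).
by rewrite mulmxBl mul1mx mulmxA.
Qed.

Lemma presidualB (R : realType) (n : nat) (A P : 'M[R]_n)
    (b y z : 'cV[R]_n) :
  presidual A P b y - presidual A P b z = P *m A *m (y - z).
Proof. by rewrite /presidual -mulmxBr opprB addrA subrK -mulmxBr mulmxA. Qed.

Lemma presidual_addr (R : realType) (n : nat) (A P : 'M[R]_n)
    (b y z : 'cV[R]_n) :
  presidual A P b (y + z) = presidual A P b y + P *m A *m z.
Proof. by apply/eqP; rewrite [_ + _ *m z]addrC -subr_eq presidualB [y + z]addrC addrK. Qed.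

(** The sign change between the two sides is the convention that [R_k] holds
    the differences [r_(k-i) - r_k], older minus current. *)
Lemma residual_combination (R : realType) (n m k : nat) (B : 'M[R]_n)
    (r : nat -> 'cV[R]_n) (a : 'cV[R]_(minn k m)) :
  B *m r k +
    \sum_(i < minn k m) a i 0 *: (B *m r k - B *m r (k - i.+1)%N) =
  B *m (r k - residual_diff_mx m r k *m a).
Proof.
rewrite mulmxBr; congr (_ + _); rewrite -mulmxN.
have -> : - (residual_diff_mx m r k *m a) =
    \sum_(i < minn k m) a i 0 *: (r k - r (k - i.+1)%N).
  apply/matrixP => l j; rewrite ord1 !mxE summxE -sumrN.
  by apply: eq_bigr => i _; rewrite !mxE mulrC -mulrN opprB.
rewrite mulmx_sumr; apply: eq_bigr => i _.
by rewrite -mulmxBr scalemxAr.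
Qed.

Lemma AAr_objectiveE (R : realType) (n m : nat) (A P : 'M[R]_n)
    (b : 'cV[R]_n) (x : nat -> 'cV[R]_n) (k : nat) (a : 'cV[R]_(minn k m)) :
  AAr_objective (richardson A P b) x a =
  norm2 ((1%:M - P *m A) *m (presidual A P b (x k) -
    residual_diff_mx m (fun k => presidual A P b (x k)) k *m a)) ^+ 2.
Proof.
rewrite -(residual_combination _ (fun k => presidual A P b (x k))).
rewrite /AAr_objective subr_richardson presidual_richardson.
under eq_bigr do rewrite subr_richardson presidual_richardson.
by [].
Qed.

Lemma presidual_AAr_step (R : realType) (n m : nat) (A P : 'M[R]_n)
    (b : 'cV[R]_n) (x : nat -> 'cV[R]_n) (k : nat) (a : 'cV[R]_(minn k m)) :
  presidual A P b (AAr_step (richardson A P b) x a) =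
  (1%:M - P *m A) *m (presidual A P b (x k) -
    residual_diff_mx m (fun k => presidual A P b (x k)) k *m a).
Proof.
rewrite -(residual_combination _ (fun k => presidual A P b (x k))).
rewrite /AAr_step presidual_addr presidual_richardson; congr (_ + _).
rewrite mulmx_sumr; apply: eq_bigr => i _.
by rewrite -scalemxAr -(presidualB _ _ b) !presidual_richardson.
Qed.

(** The index [i = 0], which has no column in [R_k], gives the zero vector. *)
Lemma residual_diff_in_range (R : realType) (n m : nat) (r : nat -> 'cV[R]_n)
    (k i : nat) : (i <= minn k m)%N ->
  exists s : 'cV[R]_(minn k m), r (k - i)%N - r k = residual_diff_mx m r k *m s.
Proof.
case: i => [|i] im; first by exists 0; rewrite subn0 subrr mulmx0.
exists (delta_mx (Ordinal im) 0); rewrite -colE.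
by apply/matrixP => l j; rewrite ord1 !mxE.
Qed.

(** * Convergence *)

(** Residual and error determine each other through the invertible matrix [PA],
    so the geometric decay of [r_k] carries over to the coordinates of
    [x_k - A^-1 b], at the cost of the constant factor [|(PA)^-1|]. *)
Lemma geometric_residual_cvg (R : realType) (n : nat) (A P : 'M[R]_n)
    (b : 'cV[R]_n) (x : nat -> 'cV[R]_n) (c : R) :
  A \in unitmx -> P \in unitmx -> 0 <= c -> c < 1 ->
  (forall k, norm2 (presidual A P b (x k.+1)) <=
     c * norm2 (presidual A P b (x k))) ->
  x @ \oo --> invmx A *m b.
Proof.
move=> hA hP c0 c1 contr; pose C := invmx A *m invmx P.
have geo k : norm2 (presidual A P b (x k)) <=
    c ^+ k * norm2 (presidual A P b (x 0)).
  elim: k => [|k IHk]; first by rewrite mul1r.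
  by apply: le_trans (contr k) _; rewrite exprS -mulrA ler_wpM2l.
have errE k : x k - invmx A *m b = C *m presidual A P b (x k).
  by rewrite /C /presidual mulmxA mulmxKV // mulmxBr mulKmx.
pose K := mxnorm2 C * norm2 (presidual A P b (x 0)).
have c_abs : `|c| < 1 by rewrite ger0_norm.
apply/cvg_ballP => e e0.
have small : \forall k \near \oo, `|geometric K c k| < e.
  exact: (@cvgr0_norm_lt _ _ _ _ _ _ (cvg_geometric K c_abs)).
near=> k; split=> // i j; rewrite ord1 -ball_normE /= distrC.
have -> : x k i 0 - (invmx A *m b) i 0 = (C *m presidual A P b (x k)) i 0.
  by rewrite -errE !mxE.
apply: le_lt_trans (coord_le_norm2 _ _) _.
apply: le_lt_trans (norm2_mulmx_le _ _) _.
have le_geo : mxnorm2 C * norm2 (presidual A P b (x k)) <= geometric K c k.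
  rewrite /geometric /= /K -mulrA [_ * c ^+ k]mulrC.
  by rewrite ler_wpM2l ?mxnorm2_ge0.
by apply: le_lt_trans le_geo (le_lt_trans (ler_norm _) _); near: k.
Unshelve. all: by end_near. Qed.

(** * Anderson acceleration of the Richardson iteration *)

Theorem theorem3p2 (R : realType) (n m : nat) (A P : 'M[R]_n) (b : 'cV[R]_n)
    (hA : A \in unitmx) (hP : P \in unitmx)
    (x : nat -> 'cV[R]_n) (alpha : forall k, 'cV[R]_(minn k m))
    (hx : is_AAr (richardson A P b) x alpha) :
  let B : 'M[R]_n := 1%:M - P *m A in
  let r : nat -> 'cV[R]_n := fun k => presidual A P b (x k) in
  (forall (k : nat) (a : 'cV[R]_(minn k m)),
     AAr_objective (richardson A P b) x a =
       norm2 (presidual A P b (AAr_step (richardson A P b) x a)) ^+ 2 /\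
     norm2 (presidual A P b (AAr_step (richardson A P b) x a)) ^+ 2 =
       norm2 (B *m (r k - residual_diff_mx m r k *m a)) ^+ 2) /\
  (forall k : nat,
     (forall i j : nat, (i <= minn k m)%N -> (j <= minn k m)%N ->
        (r k.+1)^T *m B *m (r (k - j)%N - r (k - i)%N) = 0) /\
     norm2 (r k.+1) <= norm2 (B *m r k)) /\
  (mxnorm2 B < 1 ->
     (forall k : nat, r k != 0 -> norm2 (r k.+1) < norm2 (r k)) /\
     (x @ \oo --> invmx A *m b)).
Proof.
move=> B r.
have rS k : r k.+1 = B *m (r k - residual_diff_mx m r k *m alpha k).
  by rewrite /r (hx k).2 presidual_AAr_step.
have min_r k (a : 'cV[R]_(minn k m)) :
    norm2 (r k.+1) ^+ 2 <= norm2 (B *m (r k - residual_diff_mx m r k *m a)) ^+ 2.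
  by rewrite rS -!AAr_objectiveE; exact: (hx k).1.
have r_le k : norm2 (r k.+1) <= norm2 (B *m r k).
  have := min_r k 0; rewrite mulmx0 subr0.
  by rewrite ler_sqr // nnegrE norm2_ge0.
split=> [k a|]; first by rewrite AAr_objectiveE presidual_AAr_step.
split=> [k|B1].
  split=> // i j im jm.
  have orth (s : 'cV[R]_(minn k m)) : (r k.+1)^T *m (B *m residual_diff_mx m r k *m s) = 0.
    rewrite rS mulmxBr [B *m (_ *m alpha k)]mulmxA.
    apply: least_squares_orthogonal => a.
    by rewrite -!mulmxA -!mulmxBr -rS.
  have [si riE] := residual_diff_in_range r im.
  have [sj rjE] := residual_diff_in_range r jm.
  have -> : r (k - j)%N - r (k - i)%N = residual_diff_mx m r k *m (sj - si).
    by rewrite mulmxBr -riE -rjE opprB addrA subrK.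
  by rewrite -mulmxA [B *m _]mulmxA orth.
have contr k : norm2 (r k.+1) <= mxnorm2 B * norm2 (r k).
  exact: le_trans (r_le k) (norm2_mulmx_le _ _).
split=> [k rk0|].
  by apply: le_lt_trans (contr k) _; rewrite gtr_pMl ?norm2_gt0.
exact: geometric_residual_cvg hA hP (mxnorm2_ge0 B) B1 contr.
Qed.
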